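(* Let $k\geq 0$ be an integer. Every graph $G$ with feedback vertex number at most $k$ and girth at least $7$ is $2$-colourable with clustering $\binom{k}{2}+k+1$.
   Context: Graphs are finite, simple and undirected. The feedback vertex number of a graph $G$ is the minimum size of a set $A\subseteq V(G)$ such that $G-A$ is a forest. The girth of a graph is the length of its shortest cycle (infinite for a forest). A $2$-colouring assigns one of at most two colours to each vertex (not necessarily properly). A monochromatic component is a connected component of the subgraph induced by all vertices of a single colour. A colouring has clustering $c$ if every monochromatic component has at most $c$ vertices. *)

(* Defs.v *)
(* A finite simple undirected graph is a symmetric irreflexive
   relation [e : rel V] on a finite type [V]. *)
From mathcomp Require Import all_boot.

Set Implicit Arguments.
Unset Strict Implicit.
Unset Printing Implicit Defensive.

Section Graphs.
Variable V : finType.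
Implicit Types (e : rel V) (S A C : {set V}).

Definition simple_graph e := symmetric e /\ irreflexive e.

(* The subgraph induced by [S] is kept on the vertex type [V], so that vertices
   outside [S] become isolated. They lie on no cycle; [component] below only
   collects vertices of [S]. *)
Definition induced e S : rel V := [rel x y | [&& x \in S, y \in S & e x y]].

(* [ucycleb] also accepts sequences of length 0 and 2 (an edge traversed back
   and forth), hence the lower bound on the length. *)
Definition is_cycle e (c : seq V) := (2 < size c) && ucycleb e c.

Definition has_cycle e n := [exists c : n.-tuple V, is_cycle e c].

(* Cycles have no repeated vertex, so that it is enough to consider lengths up
   to [#|V|] here and in [girth]. *)
Definition forest e := ~~ [exists n : 'I_#|V|.+1, has_cycle e n].

Definition feedback_vertex_set e A := forest (induced e (~: A)).

(* The default value [setT] is itself a feedback vertex set. *)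
Definition feedback_vertex_number e :=
  #|[arg min_(A < [set: V] | feedback_vertex_set e A) #|A|]|.

(* [None] stands for infinity. The list is increasing, hence its first item is
   its minimum. *)
Definition girth e : option nat :=
  ohead [seq n <- iota 0 #|V|.+1 | has_cycle e n].

Definition girth_at_least e n := if girth e is Some g then n <= g else true.

Definition component e S x := [set y in S | connect (induced e S) x y].

Definition components e S := [set component e S x | x in S].

Definition colour_class (I : eqType) (f : V -> I) i := [set x | f x == i].

Definition has_clustering (I : eqType) e (f : V -> I) c :=
  forall (i : I) C, C \in components e (colour_class f i) -> #|C| <= c.

(* The second colour need not be used, so this means at most two colours. *)
Definition two_colourable_with_clustering e c :=
  exists f : V -> 'I_2, has_clustering e f c.

Lemma is_cycle_has_cycle e c :
  is_cycle e c -> size c <= #|V| /\ has_cycle e (size c).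
Proof.
move=> cc; split; last by apply/existsP; exists (in_tuple c).
by case/and3P: cc => _ _ /card_uniqP <-; apply: max_card.
Qed.

Lemma forestP e : reflect (forall c, ~~ is_cycle e c) (forest e).
Proof.
apply: (iffP idP) => [/existsPn fe c | nc].
  apply/negP => /is_cycle_has_cycle [lec hc].
  by have := fe (inord (size c)); rewrite inordK ?ltnS // hc.
by apply/existsPn => n; apply/existsPn => c; apply: nc.
Qed.

Lemma feedback_vertex_setT e : feedback_vertex_set e [set: V].
Proof.
apply/forestP => -[|x [|y c]] //; apply/negP => /and3P[_ + _].
by rewrite /= /induced /= !inE.
Qed.

Lemma feedback_vertex_numberP e k :
  reflect (exists2 A, feedback_vertex_set e A & #|A| <= k)
          (feedback_vertex_number e <= k).
Proof.
rewrite /feedback_vertex_number.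
case: arg_minnP => [|A fA minA]; first exact: feedback_vertex_setT.
apply: (iffP idP) => [leAk | [B fB]]; first by exists A.
exact/leq_trans/minA.
Qed.

Lemma girth_at_leastP e n :
  reflect (forall c, is_cycle e c -> n <= size c) (girth_at_least e n).
Proof.
rewrite /girth_at_least /girth.
have mem_s m : (m \in [seq n <- iota 0 #|V|.+1 | has_cycle e n])
               = has_cycle e m && (m <= #|V|).
  by rewrite mem_filter mem_iota.
have : sorted ltn [seq n <- iota 0 #|V|.+1 | has_cycle e n].
  exact/sorted_filter/iota_ltn_sorted/ltn_trans.
case: [seq _ <- _ | _] mem_s => [|g s] mem_s /=.
  move=> _; apply: ReflectT => c /is_cycle_has_cycle [lec hc].
  by have := mem_s (size c); rewrite hc lec.
move=> /(order_path_min ltn_trans) /allP ltg.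
apply: (iffP idP) => [leng c /is_cycle_has_cycle [lec hc] | le_n].
  have := mem_s (size c); rewrite hc lec inE => /orP[/eqP -> // | /ltg].
  by move=> /ltnW; apply: leq_trans.
have := mem_s g; rewrite mem_head => /esym /andP[/existsP[c cc] _].
by rewrite -(size_tuple c); apply: le_n.
Qed.

End Graphs.

(* Main.v *)
(* Let [A] be a feedback vertex set of size at most [k] and [N] the set of
   neighbours of [A] in the forest [G - A]. Colour [A] red, [N] blue, and
   every other vertex of the rooted forest differently from its parent. A
   red component is contained in [A] or is a single vertex. In a blue
   component only the top vertex can lie outside [N]. Label each vertex of
   [N] by one neighbour in [A]. The vertices with a parent in [N] number at
   most ['C(k, 2)], because the pair of labels of an edge inside [N]
   determines the edge (no cycle of length at most 6). The other vertices of
   the component are its top vertex and, if this is outside [N], its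
   children, which have distinct labels since there is no 4-cycle. *)
Require Import Defs.
From mathcomp Require Import all_boot.

Set Implicit Arguments.
Unset Strict Implicit.
Unset Printing Implicit Defensive.

(** * Leaves and rooted colourings of forests *)

Section Forests.
Variables (V : finType) (e : rel V).
Hypotheses (sym_e : symmetric e) (irr_e : irreflexive e).
Implicit Types (A N S : {set V}).

Lemma inducedE S x y : induced e S x y = [&& x \in S, y \in S & e x y].
Proof. by []. Qed.

Lemma forest_subset S S' :
  S' \subset S -> forest (induced e S) -> forest (induced e S').
Proof.
move=> sS'S /forestP nc; apply/forestP => c; apply: contra (nc c).
rewrite /is_cycle /ucycleb => /and3P[-> cc ->]; rewrite andbT /=.
apply: sub_cycle cc => x y /and3P[xS yS xy].
by rewrite inducedE !(subsetP sS'S).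
Qed.

(* The first vertex of a maximal path has no neighbour off the path, and a
   neighbour on the path other than the second vertex closes a cycle. *)
Lemma forest_leaf S : forest (induced e S) -> S != set0 ->
  exists2 v, v \in S & {in S &, forall x y, e v x -> e v y -> x = y}.
Proof.
move=> /forestP nc /set0Pn[v0 v0S].
have [/existsP[v /andP[vS /'forall_implyP H]] | /existsPn noleaf] :=
  boolP [exists v, (v \in S) && [forall x, (x \in S) ==>
           [forall y, (y \in S) ==> (e v x ==> (e v y ==> (x == y)))]]].
  exists v => // x y xS yS vx vy; apply/eqP.
  have /'forall_implyP/(_ y yS) := H x xS.
  by rewrite vx vy.
(* Without a leaf every path extends at its front, so some path has [#|V| + 1] distinct vertices,
   which is impossible. *)
suff long n : exists x p, [/\ x \in S, path (induced e S) x p,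
                              uniq (x :: p) & size p = n].
  have [x [p [_ _ /card_uniqP up sp]]] := long #|V|.
  by have := max_card [in x :: p]; rewrite up /= sp ltnn.
elim: n => [|n [x [p [xS xp up sp]]]]; first by exists v0, [::].
suff [w [wS xw wp]] : exists w, [/\ w \in S, e x w & w \notin p].
  exists w, (x :: p); split => //; last by rewrite /= sp.
    by rewrite /= inducedE wS xS sym_e xw.
  rewrite cons_uniq up inE negb_or wp !andbT.
  by apply: contraTneq xw => ->; rewrite irr_e.
(* [head x p] is the second vertex of the path, or [x] itself if [p] is empty. One of two distinct
   neighbours of [x] avoids it. *)
have [w [wS xw wh]] : exists w, [/\ w \in S, e x w & w != head x p].
  have := noleaf x; rewrite xS /= => /forallPn[y].
  rewrite negb_imply => /andP[yS /forallPn[z]].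
  rewrite !negb_imply => /and4P[zS xy xz yz].
  have [yh|] := eqVneq y (head x p); last by exists y.
  by exists z => //; rewrite -yh eq_sym.
exists w; split=> //; apply/negP => wp.
case/splitPr: wp xp up wh {sp} => p1 p2.
rewrite -cat1s catA cat_path -cat_cons cat_uniq => /andP[xp _] /andP[up _] wh.
(* As [w] is not the second vertex, [p1] is nonempty and the cycle has length at least 3. *)
have /negP[] := nc (x :: p1 ++ [:: w]); rewrite /is_cycle /ucycleb up andbT.
apply/andP; split; first by case: p1 {xp up} wh => [|a l] /=;
  rewrite ?eqxx // size_cat addn1.
by rewrite /= rcons_path xp last_cat /= inducedE wS xS sym_e xw.
Qed.

(* A vertex outside [N] gets the colour opposite to its parent, so that it can
   only be the top vertex [top v] of its [true]-coloured component. The inequality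
   [par (par v) <> v] makes [v |-> {v, par v}] injective. *)
Lemma forest_colouring N S : forest (induced e S) ->
  exists (f : V -> bool) (top par : V -> V),
  [/\ {in S, forall v, v \in N -> f v},
      {in S &, forall u v, e u v -> f u || f v},
      {in S &, forall u v, e u v -> f u -> f v -> top u = top v},
      {in S, forall v, top v \in S /\ par v \in S} &
      {in S, forall v, f v -> v <> top v ->
        [/\ v \in N, f (par v), e v (par v), top (par v) = top v
          & par (par v) <> v]}].
Proof.
have [n] := ubnP #|S|; elim: n S => // n IH S leS fS.
have [->|S0] := eqVneq S set0.
  by exists xpredT, id, id; split => v; rewrite !inE.
(* Colour [S] without a leaf [v] by induction, then make the neighbour of [v] in [S], if any, its
   parent. *)
have [v vS leaf] := forest_leaf fS S0.
have sS' : S :\ v \subset S by apply: subD1set.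
have [|f [top [par [fN fE topE tpS parP]]]] :=
    IH (S :\ v) _ (forest_subset sS' fS).
  by rewrite (cardsD1 v) vS in leS.
pose upd T (g : V -> T) a x := if x == v then a else g x.
have updv T (g : V -> T) a : upd T g a v = a by rewrite /upd eqxx.
have updn T (g : V -> T) a x : x \in S :\ v -> upd T g a x = g x.
  by rewrite !inE /upd => /andP[/negPf->].
have parS x : x \in S :\ v -> par x \in S :\ v by move=> /tpS[].
have tpS' x : x \in S :\ v -> top x \in S /\ par x \in S.
  by move=> /tpS[tS pS]; rewrite !(subsetP sS').
have inS x : x \in S -> x = v \/ x \in S :\ v.
  by rewrite !inE; case: eqVneq => [->|]; [left|right].
have [/existsP[u /andP[uS' vu]] | /existsPn nou] :=
    boolP [exists u, (u \in S :\ v) && e v u]; last first.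
  have noev x : x \in S :\ v -> e v x = false.
    by move=> xS; apply/negbTE; have := nou x; rewrite xS.
  exists (upd _ f true), (upd _ top v), (upd _ par v); split.
  - by move=> x /inS[->|xS]; rewrite ?updv ?updn //; apply: fN.
  - move=> x y /inS[->|xS] /inS[->|yS]; rewrite ?updv ?updn ?orbT //; exact: fE.
  - move=> x y /inS[->|xS] /inS[->|yS]; rewrite ?updv ?updn ?irr_e ?noev //.
      by rewrite sym_e noev.
    exact: topE.
  - by move=> x /inS[->|xS]; rewrite ?updv ?updn //; exact: tpS'.
  - move=> x /inS[->|xS]; rewrite ?updv ?updn ?parS //; exact: parP.
have uS := subsetP sS' _ uS'.
have nbv x : x \in S :\ v -> e v x -> x = u.
  by move=> xS' vx; apply: leaf => //; apply: (subsetP sS').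
(* [par] maps [S :\ v] to itself, so [par (par v) <> v] will hold once [u] is the parent of [v]. *)
have uv : par u <> v by move=> E; have [_] := tpS u uS'; rewrite E !inE eqxx.
pose b := (v \in N) || ~~ f u.
(* If [f u] is false, [v] is the top vertex of a new component. *)
exists (upd _ f b), (upd _ top (if f u then top u else v)), (upd _ par u); split.
- move=> x /inS[->|xS]; rewrite ?updv ?updn //; last exact: fN.
  by rewrite /b => ->.
- move=> x y /inS[->|xS] /inS[->|yS]; rewrite ?updv ?updn ?irr_e //.
  + by move=> /(nbv _ yS)->; rewrite /b -orbA orNb orbT.
  + by rewrite sym_e => /(nbv _ xS)->; rewrite /b orbCA orbN orbT.
  + exact: fE.
- move=> x y /inS[->|xS] /inS[->|yS]; rewrite ?updv ?updn ?irr_e //.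
  + by move=> /(nbv _ yS)-> _ ->.
  + by rewrite sym_e => /(nbv _ xS)-> ->.
  + exact: topE.
- move=> x /inS[->|xS]; rewrite ?updv ?updn //; last exact: tpS'.
  by case: (f u); rewrite ?(tpS' u uS').1.
- move=> x /inS[->|xS]; rewrite ?updv ?updn ?parS //; last exact: parP.
  by rewrite /b; case: (f u) => //; rewrite orbF => vN _.
Qed.

End Forests.

Lemma connect_ind (T : finType) (r : rel T) (P : T -> Prop) x y :
  (forall u v, r u v -> P u -> P v) -> P x -> connect r x y -> P y.
Proof.
move=> rP Px /connectP[p + ->]; elim: p x Px => //= z p IH x Px /andP[xz].
exact: IH (rP _ _ xz Px).
Qed.

(** * Counting by labels in a graph without short cycles *)

Section Labels.
Variables (V : finType) (e : rel V) (A N : {set V}) (lab : V -> V).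
Hypotheses (sym_e : symmetric e) (irr_e : irreflexive e).
Hypothesis girth_e : girth_at_least e 7.
Hypothesis labP : {in N, forall v, [/\ v \notin A, lab v \in A & e v (lab v)]}.

Lemma no_short_cycle c : 2 < size c -> size c < 7 -> cycle e c -> uniq c -> False.
Proof.
move=> c2 c7 cc uc; move/girth_at_leastP/(_ c): girth_e.
by rewrite /is_cycle /ucycleb c2 cc uc leqNgt c7 => /(_ isT).
Qed.

(** Otherwise [x u y v] is a 4-cycle. *)
Lemma common_neighbours_eq x y u v :
  e x u -> e x v -> e y u -> e y v -> x != y -> u = v.
Proof.
move=> xu xv yu yv nxy; apply/eqP/negPn/negP => nuv.
have ne a b : e a b -> (a == b) = false.
  by move=> ab; apply: contraTF ab => /eqP->; rewrite irr_e.
exfalso; apply: (@no_short_cycle [:: x; u; y; v]) => //.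
  by rewrite /= xu sym_e yu yv sym_e xv.
rewrite /= !inE (ne _ _ xu) (ne _ _ xv) (negPf nxy) (negPf nuv) /=.
by rewrite eq_sym (ne _ _ yu) (ne _ _ yv).
Qed.

(** A common label would form a triangle with the edge. *)
Lemma lab_edge_neq u v : u \in N -> v \in N -> e u v -> lab u != lab v.
Proof.
move=> uN vN uv; apply/eqP => luv.
have [_ lA ul] := labP uN; have [_ _ vl] := labP vN; rewrite -luv in vl.
exfalso; apply: (@no_short_cycle [:: u; v; lab u]) => //.
  by rewrite /= uv vl sym_e ul.
rewrite /= !inE !negb_or.
have ne a b : e a b -> a != b.
  by move=> ab; apply: contraTneq ab => ->; rewrite irr_e.
by rewrite !ne.
Qed.

(* Otherwise [u v (lab v) v' u' (lab u)] contains a cycle of length at most 6. *)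
Lemma lab_edge_inj u v u' v' :
  u \in N -> v \in N -> u' \in N -> v' \in N -> e u v -> e u' v' ->
  lab u = lab u' -> lab v = lab v' -> u = u' /\ v = v'.
Proof.
move=> uN vN u'N v'N uv u'v' lu lv.
have [_ aA ua] := labP uN; have [_ bA vb] := labP vN.
have [_ _ u'a] := labP u'N; have [_ _ v'b] := labP v'N.
rewrite -lu in u'a; rewrite -lv in v'b.
have nab := lab_edge_neq uN vN uv.
have nA x y : x \in N -> y \in A -> x != y.
  by move=> xN yA; apply: contraTneq yA => <-; case: (labP xN).
(* If the edges share exactly one end, the other two ends and their common label close a 4-cycle; if
   they share none, there is a 6-cycle. *)
have [uu'|nuu'] := eqVneq u u'; last have [vv'|nvv'] := eqVneq v v'.
- split=> //; apply/eqP/negPn/negP => nvv'; rewrite -uu' in u'v'.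
  have E : u = lab v by apply: (@common_neighbours_eq v v') => //; rewrite sym_e.
  by have := nA u (lab v) uN bA; rewrite {1}E eqxx.
- have E : v = lab u.
    by apply: (@common_neighbours_eq u u') => //; rewrite vv'.
  by have := nA v (lab u) vN aA; rewrite {1}E eqxx.
have nlab x y : x \in N -> y \in N -> lab x != lab y -> x != y.
  by move=> _ _; apply: contra_neq => ->.
exfalso; apply: (@no_short_cycle [:: u; v; lab v; v'; u'; lab u]) => //.
  by rewrite /= uv vb sym_e v'b sym_e u'v' u'a sym_e ua.
have nuv : u != v by rewrite nlab.
have nuv' : u != v' by rewrite nlab // -lv.
have nvu' : v != u' by rewrite nlab // -lu eq_sym.
have nv'u' : v' != u' by rewrite nlab // -lu -lv eq_sym.
rewrite /= !inE !negb_or nuv nuv' nuu' nvv' nvu' nv'u' /=.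
rewrite (eq_sym _ v') (eq_sym _ u') (eq_sym (lab v)) nab andbT.
by rewrite !(nA u) // !(nA v) // !(nA v') // !(nA u').
Qed.

Lemma card_lab_component (C : {set V}) r (par : V -> V) : r \notin A ->
  {in C, forall v, v <> r -> [/\ v \in N, e v (par v), par (par v) <> v
                              & par v \in N \/ par v = r]} ->
  #|C| <= 'C(#|A|, 2) + #|A| + 1.
Proof.
move=> rA CP.
pose D1 := [set v in C :\ r | par v \in N].
pose D2 := [set v in C :\ r | par v \notin N].
have leD1 : #|D1| <= 'C(#|A|, 2).
  have D1P v : v \in D1 ->
      [/\ v \in N, par v \in N, e v (par v) & par (par v) <> v].
    by rewrite !inE -andbA => /and3P[/eqP vr vC pN]; have [] := CP v vC vr.
  pose g v := [set lab v; lab (par v)].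
  rewrite -cards_draws -(@card_in_imset _ _ g) =>
    [|u v /D1P[uN puN upu _] /D1P[vN pvN vpv ppv] guv].
    apply/subset_leq_card/subsetP => _ /imsetP[v /D1P[vN pvN vpv _] ->].
    rewrite inE cards2 lab_edge_neq // eqxx andbT subUset !sub1set.
    by have [_ -> _] := labP vN; have [_ -> _] := labP pvN.
  have nu := lab_edge_neq uN puN upu.
  (* Equal pairs matched in order give [u = v]. Matched crosswise they give [u = par v] and
     [par u = v], against [par (par v) <> v]. *)
  have : lab u \in g v by rewrite -guv set21.
  have : lab (par u) \in g v by rewrite -guv set22.
  rewrite !in_set2 => /orP[] /eqP lpu /orP[] /eqP lu.
  - by rewrite lu lpu eqxx in nu.
  - rewrite sym_e in vpv.
    by have [E F] := lab_edge_inj uN puN pvN vN upu vpv lu lpu; rewrite -E F in ppv.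
  - by have [] := lab_edge_inj uN puN vN pvN upu vpv lu lpu.
  - by rewrite lu lpu eqxx in nu.
have leD2 : #|D2| <= #|A|.
  have D2P v : v \in D2 -> v \in N /\ e v r.
    rewrite !inE -andbA => /and3P[/eqP vr vC pN].
    have [vN vp _ [pvN|pvr]] := CP v vC vr; first by rewrite pvN in pN.
    by rewrite -pvr.
  rewrite -(@card_in_imset _ _ lab) => [|u v /D2P[uN ur] /D2P[vN vr] luv].
    by apply/subset_leq_card/subsetP => _ /imsetP[v /D2P[/labP[_ lA _] _] ->].
  have [_ lA ul] := labP uN; have [_ _ vl] := labP vN; rewrite -luv in vl.
  (* Distinct [u] and [v] have both [r] and their label as common neighbours, so [r] would be that
     label and lie in [A]. *)
  apply/eqP; apply: contraNT rA => nuv.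
  by rewrite (common_neighbours_eq ur ul vr vl nuv).
have CD : C :\ r = D1 :|: D2.
  by apply/setP => v; rewrite !in_set -andb_orr orbN andbT.
rewrite (cardsD1 r C) addnC leq_add ?leq_b1 // CD.
by apply: leq_trans (leq_card_setU _ _) _; rewrite leq_add.
Qed.

End Labels.

(** * Colouring the whole graph *)

Theorem theorem21 (k : nat) (V : finType) (e : rel V)
  (simple_e : simple_graph e)
  (fvn_e : feedback_vertex_number e <= k)
  (girth_e : girth_at_least e 7) :
  two_colourable_with_clustering e ('C(k, 2) + k + 1).
Proof.
have [sym_e irr_e] := simple_e.
have [A fA leAk] := feedback_vertex_numberP _ _ fvn_e.
suff [f fP] : exists f : V -> 'I_2, has_clustering e f ('C(#|A|, 2) + #|A| + 1).
  exists f => i C /fP/leq_trans; apply.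
  by rewrite leq_add2r leq_add // leq_bin2l.
pose N := [set v in ~: A | [exists a in A, e v a]].
pose lab v := odflt v [pick a in A | e v a].
have labP : {in N, forall v, [/\ v \notin A, lab v \in A & e v (lab v)]}.
  move=> v; rewrite !inE => /andP[vA /exists_inP[a aA va]]; rewrite /lab vA.
  by case: pickP => [b /andP[]|/(_ a)] //=; rewrite aA va.
have [f [top [par [fN fE topE tpS parP]]]] := forest_colouring sym_e irr_e N fA.
(* Colour 1 is blue and colour 0 is red. *)
exists (fun v => inord ((v \notin A) && f v)) => i _ /imsetP[x xi ->].
set S := colour_class _ _ in xi *.
have sameS u v : u \in S -> v \in S -> (u \notin A) && f u = (v \notin A) && f v.
  rewrite !inE => /eqP <- /eqP/(congr1 val).
  by rewrite /= !inordK ?ltnS ?leq_b1 //; do 2!case: (_ && _).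
(* A red component meeting [A] cannot leave it, as all neighbours of [A] outside [A] lie in [N] and
   are blue. *)
have [xA|xA] := boolP (x \in A).
  apply: (@leq_trans #|A|); last by rewrite -addnA addnCA leq_addr.
  apply/subset_leq_card/subsetP => y; rewrite inE => /andP[_].
  apply: (connect_ind (P := fun y => y \in A)) => // u v /and3P[uS vS uv] uA.
  have := sameS u v uS vS; rewrite uA /=; apply: contra_eqT => vA.
  by rewrite vA fN ?inE //= vA; apply/exists_inP; exists u; rewrite // sym_e.
(* A red [x] outside [A] has no red neighbour: one in [A] would put [x] in [N], and one outside [A]
   is blue by [fE]. *)
have [fx|fx] := boolP (f x); last first.
  apply: (@leq_trans #|[set x]|); last by rewrite cards1 leq_addl.
  apply/subset_leq_card/subsetP => y.
  rewrite in_set in_set1 => /andP[_] xy; apply/eqP.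
  apply: (connect_ind (P := fun y => y = x)) xy => // u v /and3P[_ vS + ux].
  rewrite {u}ux => xv.
  have := sameS x v xi vS; rewrite xA (negPf fx) /=.
  have [vA _|vA] := boolP (v \in A); last first.
    have : f x || f v by apply: fE; rewrite ?inE.
    by rewrite (negPf fx) /= => ->.
  by case/negP: fx; rewrite fN ?inE ?xA //; apply/exists_inP; exists v.
have Sf v : v \in S -> v \in ~: A /\ f v.
  by move=> vS; have := sameS x v xi vS; rewrite xA fx inE => /esym/andP.
apply: (card_lab_component sym_e irr_e girth_e labP (r := top x) (par := par)).
  by have [] := tpS x; rewrite !inE.
move=> y; rewrite in_set => /andP[yS xy].
have <- : top y = top x.
  apply: (connect_ind (P := fun y => top y = top x)) xy => // u v.
  move=> /and3P[/Sf[uA fu] /Sf[vA fv] uv] <-; apply: topE => //.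
  by rewrite sym_e.
have [yA fy] := Sf y yS; move=> /(parP y yA fy)[yN fp yp tp pp]; split=> //.
(* The parent of [y] is blue, so outside [N] it can only be the top vertex. *)
have [pN|pN] := boolP (par y \in N); [by left | right; rewrite -tp].
apply/eqP/negPn/negP => /eqP pt.
by have [pN'] := parP _ (tpS y yA).2 fp pt; rewrite pN' in pN.
Qed.
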